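(* Let $n\ge0$ be an integer and $\mathcal P_n$ the space of complex polynomials of degree at most $n$. Let $R'$ be the operator $f(x)\mapsto f(-x-1)$ on $\mathcal P_n$ (i.e. $E(1,-x)$) and $J_n$ the operator $x^p\mapsto x^{n-p}$. Then $$U_n\,R'\,U_n^{-1}=(-1)^nJ_n .$$
   Context: The Euler polynomials $A_k(x)$ are defined by $\frac{A_k(x)}{(1-x)^{k+1}}=\sum_{m\ge0}m^kx^m$, with $A_0=1$. $U_n$ is the linear operator on $\mathcal P_n$ with $U_n x^p=\frac1{n!}(1-x)^{n-p}A_p(x)$, $p=0,\dots,n$; it is invertible with $U_n^{-1}x^p=(x)_p[x+1]_{n-p}$, where $(\varphi)_k=\varphi(\varphi-1)\cdots(\varphi-k+1)$ and $[\varphi]_k=\varphi(\varphi+1)\cdots(\varphi+k-1)$, both $=1$ for $k=0$. *)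

(* Defs.v *)
From HB Require Import structures.
From mathcomp Require Import all_boot all_order all_algebra.
From mathcomp Require Import boolp reals complex ring.
Set Implicit Arguments.
Unset Strict Implicit.
Unset Printing Implicit Defensive.
Import Order.TTheory GRing.Theory Num.Theory.
Local Open Scope ring_scope.

Section EulerPolynomials.
Variable F : numFieldType.
Implicit Types A : {poly F}.

(* A / (1 - x)^(k+1) = \sum_(m >= 0) m^k x^m as formal power series, i.e.
   A = (1 - x)^(k+1) * \sum_(m >= 0) m^k x^m, coefficient by coefficient (the
   right-hand sides being Cauchy products); 0^0 = 1, so that A = 1 for k = 0. *)
Definition is_euler_poly (k : nat) A : Prop :=
  forall m : nat,
    A`_m = \sum_(i < m.+1) ((1 - 'X) ^+ k.+1 : {poly F})`_(m - i) * i%:R ^+ k.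

Lemma is_euler_poly_uniq k A B :
  is_euler_poly k A -> is_euler_poly k B -> A = B.
Proof. by move=> hA hB; apply/polyP => m; rewrite hA hB. Qed.

Fixpoint euler_rec (k : nat) : {poly F} :=
  if k is j.+1 then
    'X * (1 - 'X) * (euler_rec j)^`() + j.+1%:R * 'X * euler_rec j
  else 1.

Lemma size_euler_rec k : (size (euler_rec k) <= k.+1)%N.
Proof.
elim: k => [|k IH] /=; first by rewrite size_poly1.
have s1 : (size (('X * (1 - 'X))%R : {poly F}) <= 3)%N.
  apply: leq_trans (size_polyMleq _ _) _.
  rewrite size_polyX -opprB size_polyN -polyC1 size_XsubC //.
have s2 : (size ((k.+1%:R * 'X)%R : {poly F}) <= 2)%N.
  by rewrite mulr_natl -scaler_nat (leq_trans (size_scale_leq _ _)) ?size_polyX.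
have s3 : (size (euler_rec k)^`() <= k)%N.
  apply/leq_sizeP => j kj; rewrite coef_deriv.
  by move/leq_sizeP: IH => ->; rewrite ?mul0rn.
apply: leq_trans (size_polyD _ _) _; rewrite geq_max; apply/andP; split.
  apply: leq_trans (size_polyMleq _ _) _.
  by have := leq_add s1 s3; case: (_ + _)%N => [|s] //=.
apply: leq_trans (size_polyMleq _ _) _.
by have := leq_add s2 IH; case: (_ + _)%N => [|s] //=.
Qed.

Lemma euler_recP k : is_euler_poly k (euler_rec k).
Proof.
move=> m; pose N := m.+1.
pose S j : {poly F} := \poly_(i < N) (i%:R ^+ j).
have SE j : 'X * (S j)^`() = S j.+1.
  apply/polyP => -[|i]; rewrite coefXM /S coef_poly /=.
    by rewrite exprS mul0r.
  rewrite coef_deriv coef_poly exprS.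
  by case: ifP => _; rewrite ?mul0rn // mulr_natl.
have [Q ->] : exists Q, euler_rec k = (1 - 'X) ^+ k.+1 * S k + 'X^N * Q.
  elim: k => [|k [Q /= ->]].
    exists 1; rewrite expr1 mulr1.
    have -> : S 0%N = \sum_(i < N) 'X^i.
      by rewrite /S poly_def; apply: eq_bigr => i _; rewrite expr0 scale1r.
    by rewrite -[1 - 'X]opprB mulNr -subrX1 opprB subrK.
  exists ((1 - 'X) * (N%:R * Q + 'X * Q^`()) + k.+1%:R * 'X * Q).
  have XN : 'X * ('X^N)^`() = N%:R * 'X^N :> {poly F}.
    by rewrite derivXn mulrnAr -exprS mulr_natl.
  rewrite derivD !derivM deriv_exp derivB derivX derivC -SE /=.
  set s := S k; set ds := s^`(); set dq := Q^`().
  transitivity ((1 - 'X) * (- k.+1%:R * 'X * (1 - 'X) ^+ k * s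
     + (1 - 'X) ^+ k.+1 * ('X * ds) + ('X * ('X^N)^`()) * Q + 'X * 'X^N * dq)
     + k.+1%:R * 'X * ((1 - 'X) ^+ k.+1 * s + 'X^N * Q)).
    by rewrite -mulr_natl; ring.
  by rewrite XN !exprS; ring.
rewrite coefD coefXnM ltnSn addr0 coefMr; apply: eq_bigr => i _.
by rewrite coef_poly ltn_ord.
Qed.

Lemma euler_poly_ex k : exists A, is_euler_poly k A.
Proof. by exists (euler_rec k); apply: euler_recP. Qed.

Definition euler_poly (k : nat) : {poly F} := sval (cid (euler_poly_ex k)).

Lemma euler_polyP k : is_euler_poly k (euler_poly k).
Proof. exact: svalP (cid (euler_poly_ex k)). Qed.

Lemma euler_polyE k : euler_poly k = euler_rec k.
Proof. exact: is_euler_poly_uniq (@euler_polyP k) (@euler_recP k). Qed.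

Lemma euler_poly0 : euler_poly 0 = 1.
Proof. exact: euler_polyE. Qed.

Lemma size_euler_poly k : (size (euler_poly k) <= k.+1)%N.
Proof. by rewrite euler_polyE size_euler_rec. Qed.

End EulerPolynomials.

(* {poly_n.+1 F} is the space of polynomials of size <= n+1, i.e. degree <= n.
   npolyp truncates, but is only ever applied below to polynomials of degree
   <= n, as the lemmas U_opX, refl_opE, J_opX show. *)
Section Operators.
Variables (F : numFieldType) (n : nat).
Local Notation Pn := {poly_n.+1 F}.

(* The linear operator on Pn with x^p |-> g p for p = 0, ..., n. *)
Definition monomial_fun (g : nat -> {poly F}) (f : Pn) : Pn :=
  \sum_(p < n.+1) f`_p *: npolyp n.+1 (g p).

Lemma monomial_fun_is_linear g : linear (monomial_fun g).
Proof.
move=> a u v; rewrite /monomial_fun scaler_sumr -big_split /=.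
by apply: eq_bigr => p _; rewrite coefD coefZ scalerDl scalerA.
Qed.
HB.instance Definition _ g :=
  GRing.isLinear.Build F Pn Pn _ (monomial_fun g) (@monomial_fun_is_linear g).

Definition monomial_op (g : nat -> {poly F}) : 'End(Pn) :=
  linfun (monomial_fun g).

Lemma monomial_opX (g : nat -> {poly F}) (p : nat) : (p <= n)%N -> (size (g p) <= n.+1)%N ->
  polyn (monomial_op g (npolyp n.+1 'X^p)) = g p.
Proof.
move=> lepn sg; rewrite /monomial_op lfunE /= /monomial_fun.
rewrite (bigD1 (Ordinal (lepn : p < n.+1)%N)) //= big1 => [|i neq].
  by rewrite addr0 /= npolypK ?size_polyXn // coefXn eqxx scale1r npolypK.
rewrite npolypK ?size_polyXn // coefXn; case: eqP => [ip|_]; last by rewrite scale0r.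
by case/eqP: neq; apply: val_inj.
Qed.

(* The inverse _^-1 on 'End(Pn) is total, and is the two-sided inverse for a
   bijective argument. An equation U_op \o f \o U_op^-1 = g with g bijective
   (e.g. g = c *: J_op, c != 0) forces U_op to be onto, hence bijective. *)
Definition U_op : 'End(Pn) :=
  monomial_op (fun p => (n`!%:R)^-1 *: ((1 - 'X) ^+ (n - p) * euler_poly F p)).

Definition refl_fun (f : Pn) : Pn := npolyp n.+1 (f \Po (- 'X - 1)).

Lemma size_refl (f : Pn) : (size ((polyn f \Po (- 'X - 1))%R) <= n.+1)%N.
Proof.
have -> : - 'X - 1 = - ('X - (-1)%:P) :> {poly F}.
  by rewrite polyCN opprB addrC.
by rewrite size_comp_poly2 ?size_polyN ?size_XsubC // size_npoly.
Qed.

Lemma refl_fun_is_linear : linear refl_fun.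
Proof.
move=> a u v; apply: val_inj => /=.
rewrite npolypK ?size_refl // !npolypK ?size_refl //.
by rewrite comp_polyD comp_polyZ.
Qed.
HB.instance Definition _ :=
  GRing.isLinear.Build F Pn Pn _ refl_fun refl_fun_is_linear.

(* f(x) |-> f(-x-1) *)
Definition refl_op : 'End(Pn) := linfun refl_fun.

Definition J_op : 'End(Pn) := monomial_op (fun p => 'X^(n - p)).

Lemma U_opX p : (p <= n)%N ->
  polyn (U_op (npolyp n.+1 'X^p)) =
    (n`!%:R)^-1 *: ((1 - 'X) ^+ (n - p) * euler_poly F p).
Proof.
move=> lepn; apply: (monomial_opX lepn).
apply: leq_trans (size_scale_leq _ _) _.
apply: leq_trans (size_polyMleq _ _) _.
have s1 : (size (((1 - 'X) ^+ (n - p))%R : {poly F}) <= (n - p).+1)%N.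
  apply: leq_trans (size_poly_exp_leq _ _) _.
  by rewrite -opprB size_polyN -polyC1 size_XsubC mul1n.
have := leq_add s1 (size_euler_poly F p).
by rewrite addSn addnS subnK //; case: (_ + _)%N.
Qed.

Lemma refl_opE (f : Pn) : polyn (refl_op f) = polyn f \Po (- 'X - 1).
Proof. by rewrite /refl_op lfunE /= npolypK ?size_refl. Qed.

Lemma J_opX p : (p <= n)%N -> polyn (J_op (npolyp n.+1 'X^p)) = 'X^(n - p).
Proof.
by move=> lepn; apply: (monomial_opX lepn); rewrite size_polyXn ltnS leq_subr.
Qed.

End Operators.

(* Main.v *)
Require Import Defs.
From mathcomp Require Import all_boot all_order all_algebra.
From mathcomp Require Import reals complex ring.
Import GRing.Theory Num.Theory.
Local Open Scope ring_scope.

(* Since U_n f = (1 - x)^(n+1) / n! * \sum_(m >= 0) f(m) x^m, the polynomial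
   b_p = (x)_p [x+1]_(n-p), whose value at m is n! * 'C(m - p + n, n) for
   m >= p and 0 for m < p, is sent by U_n to x^p. The zeros of b_p are the
   integers from p - n to p - 1, and x |-> -x-1 maps them onto the zeros of
   b_(n-p); hence b_p(-x-1) = (-1)^n b_(n-p)(x), and U_n turns this into
   x^p |-> (-1)^n x^(n-p). *)

(** Coefficients up to [m] only see the truncation [S] of the series of [s], so this is
    associativity of polynomial multiplication. *)
Lemma coefM_cauchy (F : comNzRingType) (A B C : {poly F}) (s : nat -> F) :
  (forall m, A`_m = \sum_(i < m.+1) B`_(m - i) * s i) ->
  forall m, (C * A)`_m = \sum_(i < m.+1) (C * B)`_(m - i) * s i.
Proof.
move=> AE m; pose S : {poly F} := \poly_(i < m.+1) s i.
transitivity (C * (B * S))`_m.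
  rewrite !coefMr; apply: eq_bigr => -[j lejm] _ /=; congr (_ * _).
  rewrite AE coefMr; apply: eq_bigr => -[i leij] _ /=.
  by rewrite coef_poly (leq_trans leij lejm).
rewrite mulrA coefMr; apply: eq_bigr => i _.
by rewrite coef_poly ltn_ord.
Qed.

(* (1 - x)^(n+1) and \sum_i 'C(i + n, n) x^i are inverse power series. *)
Lemma sum_coef_bin (F : comNzRingType) (n m : nat) :
  \sum_(i < m.+1) ((1 - 'X) ^+ n.+1 : {poly F})`_(m - i) * 'C(i + n, n)%:R
    = (m == 0%N)%:R.
Proof.
pose T k : {poly F} := \poly_(i < m.+1) 'C(i + k, k)%:R.
have -> : \sum_(i < m.+1) ((1 - 'X) ^+ n.+1 : {poly F})`_(m - i) * 'C(i + n, n)%:R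
    = ((1 - 'X) ^+ n.+1 * T n)`_m.
  by rewrite coefMr; apply: eq_bigr => i _; rewrite coef_poly ltn_ord.
elim: n => [|n IH].
  rewrite expr1 mulrBl mul1r coefB coefXM !coef_poly ltnSn bin0.
  case: m {T} => [|m]; first by rewrite subr0.
  by rewrite /= bin0 ltnS leqnSn subrr.
(* Peel off one factor 1 - x: by Pascal's rule, (1 - x) * [T n.+1] agrees with [T n] up to degree
   [m]. *)
rewrite -IH exprSr -mulrA !coefMr; apply: eq_bigr => -[i leim] _ /=; congr (_ * _).
rewrite mulrBl mul1r coefB coefXM !coef_poly leim.
case: i leim => [|i] ltim /=; first by rewrite !binn subr0.
rewrite (ltnW ltim) !addnS !addSn binS natrD.
by rewrite addrAC subrr add0r.
Qed.

Section Conjugation.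
Variables (F : numFieldType) (n : nat).
Local Notation Pn := {poly_n.+1 F}.

Lemma npolyX_sum (f : Pn) : f = \sum_(p < n.+1) f`_p *: npolyp n.+1 'X^p.
Proof.
rewrite {1}(coord_basis (npolyX_full F n.+1) (memvf f)).
by apply: eq_bigr => p _; rewrite npolyX_coords nth_npolyX tnth_map tnth_ord_tuple.
Qed.

Lemma coef_U_op (f : Pn) (m : nat) :
  (U_op F n f)`_m = (n`!%:R)^-1 *
    \sum_(i < m.+1) ((1 - 'X) ^+ n.+1 : {poly F})`_(m - i) * (polyn f).[i%:R].
Proof.
rewrite {1}[f]npolyX_sum linear_sum coefn_sum.
under eq_bigr => p _.
  have lepn : (p <= n)%N by rewrite -ltnS.
  rewrite linearZ /= coefZ U_opX // coefZ.
  (* The factor (1 - x)^(n-p) raises the exponent p + 1 to n + 1, which does not depend on [p], so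
     the sum over [p] can move inside. *)
  rewrite (coefM_cauchy _ _ _ _ (fun i => i%:R ^+ p) (@euler_polyP F p)).
  rewrite -exprD addnS subnK // mulrCA.
  over.
rewrite -mulr_sumr; congr (_ * _).
under eq_bigr => p _ do rewrite mulr_sumr.
rewrite exchange_big; apply: eq_bigr => i _ /=.
rewrite (horner_coef_wide _ (size_npoly f)) mulr_sumr.
by apply: eq_bigr => p _; rewrite mulrCA.
Qed.

(* [(x)_p [x+1]_(n-p)] for p <= n, the factors being listed in increasing order. *)
Definition falling_rising (p : nat) : {poly F} :=
  \prod_(i < n) ('X + (i.+1%:R - p%:R)%:P).

Lemma size_falling_rising p : (size (falling_rising p) <= n.+1)%N.
Proof.
rewrite /falling_rising.
under eq_bigr => i _ do rewrite -[X in _ + X]opprK -polyCN.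
by rewrite size_prod_XsubC [index_enum _]unlock -enumT size_enum_ord.
Qed.

Lemma horner_falling_rising p m : (p <= n)%N ->
  (falling_rising p).[m%:R] = if (m < p)%N then 0 else (n`! * 'C(m - p + n, n))%:R.
Proof.
move=> lepn; rewrite horner_prod.
under eq_bigr => i _ do rewrite hornerD hornerX hornerC.
case: ltnP => [ltmp|lepm].
  (* The factor of index p - m - 1 vanishes at [m]; p <= n keeps this index below [n]. *)
  have d0 : (0 < p - m)%N by rewrite subn_gt0.
  have lt : ((p - m).-1 < n)%N by rewrite prednK // (leq_trans (leq_subr _ _)).
  rewrite (bigD1 (Ordinal lt)) //= (prednK d0) natrB 1?ltnW //.
  by rewrite [_ - _ - _]addrAC subrr add0r subrr mul0r.
(* The factors at [m] are the consecutive integers from m - p + 1 to m - p + n; the falling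
   factorial lists them in decreasing order, hence the reversal. *)
rewrite mulnC bin_ffact ffact_prod natr_prod (reindex_inj rev_ord_inj) /=.
apply: eq_bigr => -[i ltin] _ /=.
rewrite subnSK // -addnBA 1?ltnW // natrD (natrB _ lepm); ring.
Qed.

Lemma U_op_falling_rising p : (p <= n)%N ->
  U_op F n (npolyp n.+1 (falling_rising p)) = npolyp n.+1 'X^p.
Proof.
move=> lepn; apply/npolyP => m.
rewrite coef_U_op !npolypK ?size_falling_rising ?size_polyXn // coefXn.
under eq_bigr => i _ do rewrite horner_falling_rising //.
have n0 : n`!%:R != 0 :> F by rewrite pnatr_eq0 -lt0n fact_gt0.
case: (ltnP m p) => [ltmp|lepm].
  rewrite big1 ?mulr0 ?ltn_eqF // => -[i leim] _ /=.
  by rewrite (leq_trans leim ltmp) mulr0.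
rewrite -(big_mkord xpredT (fun i => ((1 - 'X) ^+ n.+1 : {poly F})`_(m - i) *
  (if (i < p)%N then 0 else (n`! * 'C(i - p + n, n))%:R))).
rewrite (big_cat_nat (n := p)) ?leqW //= big_nat_cond big1 ?add0r; last first.
  by move=> i /andP[/andP[_ ->] _]; rewrite mulr0.
(* Shifting the index by [p] leaves n! times the sum of [sum_coef_bin] at m - p, which is 1 exactly
   when m = p. *)
rewrite -{1}[p]add0n big_addn subSn // big_mkord.
under eq_bigr => i _.
  rewrite ltnNge leq_addl /= addnK addnC subnDA natrM mulrCA.
  over.
by rewrite -mulr_sumr mulKf // sum_coef_bin subn_eq0 eqn_leq lepm andbT.
Qed.

Lemma falling_rising_refl p : (p <= n)%N ->
  falling_rising p \Po (- 'X - 1) = (-1) ^+ n *: falling_rising (n - p).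
Proof.
(* After reversal the factors match up to sign: n - i - p + (-x - 1) = -(x + i + 1 - (n - p)). The
   [n] signs are then distributed over the product. *)
move=> lepn; rewrite /falling_rising rmorph_prod /= (reindex_inj rev_ord_inj) /=.
rewrite -[in (-1) ^+ n](card_ord n) -prodr_const -scaler_prod.
apply: eq_bigr => -[i ltin] _ /=.
rewrite comp_polyD comp_polyX comp_polyC subnSK // !natrB // 1?ltnW //.
rewrite scaleN1r !(polyCB, polyCD) -natr1 polyCD; ring.
Qed.

Lemma U_op_refl_falling_rising p : (p <= n)%N ->
  U_op F n (refl_op F n (npolyp n.+1 (falling_rising p)))
    = (-1) ^+ n *: J_op F n (npolyp n.+1 'X^p).
Proof.
move=> lepn.
have -> : refl_op F n (npolyp n.+1 (falling_rising p))
    = (-1) ^+ n *: npolyp n.+1 (falling_rising (n - p)).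
  apply: val_inj; rewrite /= refl_opE !npolypK ?size_falling_rising //.
  exact: falling_rising_refl.
rewrite linearZ /= U_op_falling_rising ?leq_subr //; congr (_ *: _).
apply: val_inj; rewrite /= J_opX // npolypK // size_polyXn ltnS; exact: leq_subr.
Qed.

(** Every x^p is in the image, so the map is onto, and rank-nullity kills the kernel. This makes the
    total inverse of [U_op] a genuine left inverse. *)
Lemma U_op_ker0 : lker (U_op F n) == 0%VS.
Proof.
have full : limg (U_op F n) = fullv.
  apply/eqP; rewrite eqEsubv subvf; apply/subvP => f _.
  rewrite [f]npolyX_sum memv_suml // => p _; rewrite memvZ //.
  by rewrite -U_op_falling_rising -1?ltnS // memv_img ?memvf.
have := limg_ker_dim (U_op F n) fullv.
by rewrite full capfv => /eqP; rewrite -[eqbRHS]add0n eqn_add2r dimv_eq0.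
Qed.

Lemma conj_refl_op :
  (U_op F n \o refl_op F n \o (U_op F n)^-1)%VF = (-1) ^+ n *: J_op F n.
Proof.
apply/lfunP => f; rewrite [f]npolyX_sum !linear_sum; apply: eq_bigr => p _.
have lepn : (p <= n)%N by rewrite -ltnS.
rewrite !linearZ /= scale_lfunE !comp_lfunE; congr (_ *: _).
(* Writing x^p as the image of [falling_rising p] lets the inverse cancel. *)
rewrite -[in LHS]U_op_falling_rising // lker0_lfunK ?U_op_ker0 //.
exact: U_op_refl_falling_rising.
Qed.

End Conjugation.

Theorem theorem9 (R : realType) (n : nat) :
  (U_op R[i] n \o refl_op R[i] n \o (U_op R[i] n)^-1)%VF
    = (-1) ^+ n *: J_op R[i] n.
Proof. exact: conj_refl_op. Qed.
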